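(* Let $L$ be a Latin square of odd order $n$, regarded as a triple system $(V,\mathcal{B})$ whose points are the rows, columns and entries of $L$. Then $L$ admits an upper embedding in every orientation of triples. That is, for every choice, for each triple $B=\{u,v,w\}\in\mathcal{B}$, of one of the two cyclic permutations $(u,v,w)$, $(u,w,v)$, there exists an upper embedding of $(V,\mathcal{B})$ in an oriented surface $\Sigma$ such that the orientation of $\Sigma$ induces the chosen cyclic permutation on every triple $B\in\mathcal{B}$.
   Context: A (partial) triple system $\mathcal{X}=(V,\mathcal{B})$ consists of a finite point set $V$ and a collection $\mathcal{B}$ of $3$-element subsets of $V$ (called blocks or triples) such that every $2$-element subset of $V$ is contained in at most one triple of $\mathcal{B}$. Its associated graph $K$ has vertex set $V$ and edges all pairs $uv$ of distinct points such that $\{u,v\}$ is a subset of some block; thus $\mathcal{B}$ is a decomposition of the edge set of $K$ into triangles. A Latin square $L$ of order $n$, with entry $L(i,j)$ in row $i$ and column $j$ ($i,j\in\{0,\ldots,n-1\}$, entries in $\{0,\ldots,n-1\}$), is regarded as the triple system with point set $V=\mathcal{R}\cup\mathcal{C}\cup\mathcal{E}$ (disjoint union), where $\mathcal{R}=\{0_r,\ldots,(n-1)_r\}$, $\mathcal{C}=\{0_c,\ldots,(n-1)_c\}$, $\mathcal{E}=\{0_e,\ldots,(n-1)_e\}$ are the row, column and entry points, and whose set of triples is $\mathcal{B}=\{\{i_r,j_c,k_e\}: k=L(i,j)\}$. Its associated graph is the complete tripartite graph $K_{n,n,n}$. An embedding of a triple system $\mathcal{X}=(V,\mathcal{B})$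 with connected associated graph $K$ is a cellular embedding $\vartheta: K\to\Sigma$ in a (closed, connected) orientable surface $\Sigma$ (cellular: every face is an open disc) such that every triangle $B\in\mathcal{B}$ bounds a face of $\vartheta$, called the block face of $B$ (one designated face for each block). The remaining faces are called outer faces. Every edge lies on the boundary of exactly one block face. An upper embedding is an embedding of $\mathcal{X}$ with exactly one outer face. An orientation of a triple $\{u,v,w\}$ is one of the two cyclic permutations $(u,v,w)$, $(u,w,v)$. In an embedding of $\mathcal{X}$ in an oriented surface $\Sigma$, the orientation of $\Sigma$ induces on each triple $B=\{u,v,w\}$ the cyclic permutation in which $u,v,w$ appear around the centre of the triangular block face of $B$ when going round in the sense of the orientation of $\Sigma$. *)

(* Defs.v *)
From mathcomp Require Import all_boot fingroup perm matrix.

Set Implicit Arguments.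
Unset Strict Implicit.
Unset Printing Implicit Defensive.

Record triple_system (V : finType) := TripleSystem {
  blocks :> {set {set V}};
  block_card : forall B, B \in blocks -> #|B| = 3;
  block_pair : forall u v, u != v ->
    #|[set B in blocks | [set u; v] \subset B]| <= 1
}.

Section Embeddings.

Variables (V : finType) (X : triple_system V).

(* The associated graph K. *)
Definition adj (u v : V) : bool :=
  (u != v) && [exists B in blocks X, [set u; v] \subset B].

Lemma adj_sym : symmetric adj.
Proof. by move=> u v; rewrite /adj eq_sym setUC. Qed.

(* Each edge uv of K gives two darts (oriented edges), (u, v) and (v, u). *)
Definition dart := {p : V * V | adj p.1 p.2}.
Definition tail (d : dart) : V := (val d).1.
Definition head (d : dart) : V := (val d).2.

Lemma rev_subproof (d : dart) : adj (head d, tail d).1 (head d, tail d).2.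
Proof. by rewrite /= adj_sym; exact: (valP d). Qed.
Definition rev (d : dart) : dart := Sub (head d, tail d) (rev_subproof d).

Lemma rev_inj : injective rev.
Proof. by apply: (can_inj (g := rev)) => -[[u v] p]; exact: val_inj. Qed.

(* If r maps each dart to the next dart with the same tail, in the sense of   *)
(* the orientation of the surface, then d |-> r^-1 (rev d) walks around the   *)
(* face lying on the side of d towards which r turns, and it runs around the  *)
(* centre of that face in the same sense as r: if r is anticlockwise, faces   *)
(* lie to the left of their darts and are traversed anticlockwise.            *)
Definition face_perm (r : {perm dart}) : {perm dart} :=
  (perm rev_inj * r^-1)%g.
Definition faces (r : {perm dart}) : {set {set dart}} := porbits (face_perm r).

(* The facial walk F goes exactly once around the triangle B. *)
Definition bounds (F : {set dart}) (B : {set V}) : Prop :=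
  #|F| = 3 /\ [set tail d | d in F] = B.

(* A cellular embedding of a connected graph with at least one edge in an     *)
(* oriented closed connected surface is represented by its rotation system:   *)
(* at each vertex, a cyclic permutation of the darts leaving that vertex. The *)
(* faces are then the open discs whose boundary walks are the orbits of       *)
(* face_perm. A triangle may bound two faces, hence the explicit choice of    *)
(* the block faces.                                                           *)
Record embedding := Embedding {
  rotation : {perm dart};
  block_face : {set V} -> {set dart};
  embedding_connected : forall u v, connect adj u v;
  rotationP : forall d e, (e \in porbit rotation d) = (tail e == tail d);
  block_face_inj : {in X &, injective block_face};
  block_face_mem : forall B, B \in blocks X -> block_face B \in faces rotation;
  block_face_bounds : forall B, B \in blocks X -> bounds (block_face B) B
}.

Definition outer_faces (E : embedding) : {set {set dart}} :=
  faces (rotation E) :\: [set block_face E B | B in blocks X].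

Definition upper_embedding (E : embedding) : Prop := #|outer_faces E| = 1.

Definition cyclic_perm_of (B : {set V}) (s : {perm V}) : Prop :=
  perm_on B s /\ (forall x, x \in B -> porbit s x = B).

(* Only the values of o on blocks matter. *)
Definition orientation_of_triples (o : {set V} -> {perm V}) : Prop :=
  forall B, B \in blocks X -> cyclic_perm_of B (o B).

Definition induces (E : embedding) (o : {set V} -> {perm V}) : Prop :=
  forall B, B \in blocks X ->
  forall d, d \in block_face E B -> o B (tail d) = head d.

End Embeddings.

Record latin_square (n : nat) := LatinSquare {
  latin_mx :> 'M['I_n]_n;
  latin_row : forall i, injective (fun j => latin_mx i j);
  latin_col : forall j, injective (fun i => latin_mx i j)
}.

Definition point (n : nat) : finType := ('I_n + 'I_n + 'I_n)%type.

Section LatinSystem.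

Variables (n : nat) (L : latin_square n).

Definition row_pt (i : 'I_n) : point n := inl (inl i).
Definition col_pt (j : 'I_n) : point n := inl (inr j).
Definition entry_pt (k : 'I_n) : point n := inr k.

Definition latin_block (i j : 'I_n) : {set point n} :=
  [set row_pt i; col_pt j; entry_pt (L i j)].

Definition latin_blocks : {set {set point n}} :=
  [set latin_block i j | i in 'I_n, j in 'I_n].

Lemma latin_block_card B : B \in latin_blocks -> #|B| = 3.
Proof. by case/imset2P=> i j _ _ ->; rewrite /latin_block setUC cardsU1 cards2 !inE. Qed.

Lemma latin_block_inj u v i j i' j' : u != v ->
    u \in latin_block i j -> v \in latin_block i j ->
    u \in latin_block i' j' -> v \in latin_block i' j' ->
  latin_block i j = latin_block i' j'.
Proof.
have eq_row (a b : 'I_n) : (row_pt a == row_pt b) = (a == b) by [].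
have eq_col (a b : 'I_n) : (col_pt a == col_pt b) = (a == b) by [].
have eq_entry (a b : 'I_n) : (entry_pt a == entry_pt b) = (a == b) by [].
rewrite !inE => neq_uv.
do 2![case/orP=> [/orP[]|] /eqP ?]; subst u v; rewrite ?eqxx // in neq_uv *;
  rewrite ?eq_row ?eq_col ?eq_entry /= ?orbF => /eqP h1 /eqP h2; subst=> //.
- by rewrite (latin_row h2).
- by rewrite (latin_col h2).
- by rewrite (latin_row h1).
- by rewrite (latin_col h1).
Qed.

Lemma latin_block_pair u v : u != v ->
  #|[set B in latin_blocks | [set u; v] \subset B]| <= 1.
Proof.
move=> neq_uv; apply/card_le1_eqP => B C; rewrite inE => /andP[].
case/imset2P=> i j _ _ ->; rewrite subUset !sub1set => /andP[uB vB].
rewrite inE => /andP[]; case/imset2P=> i' j' _ _ ->.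
by rewrite subUset !sub1set => /andP[uC vC]; apply: (latin_block_inj neq_uv).
Qed.

Definition latin_system : triple_system (point n) :=
  TripleSystem latin_block_card latin_block_pair.

End LatinSystem.

(* Main.v *)
Require Import Defs.
From mathcomp Require Import all_boot fingroup perm matrix.

(** Call a dart (u, v) positive if the orientation [o] of its block sends u to v.
The darts leaving a point are paired off by the blocks at that point, one
positive and one negative dart for each, and [turn] exchanges the two. If every
block is to be a face of the prescribed orientation, then a rotation at a point
must go from a negative dart to some positive dart, and from each positive dart
to the negative dart of the same block; so it is the product of [turn] with a
permutation [sigma] that permutes the positive darts at each point cyclically
and is otherwise free. Let [next_perm] move each dart one step along its block.
Up to inversion and conjugation by [turn], the face permutation acts on the
negative darts as [sigma * next_perm] does on the positive ones. So there is
one outer face as soon as [sigma * next_perm] is transitive on positive darts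
([upper_embedding_of_rotation]), and what remains is to choose the cycles of
[sigma], one for each point, so that this holds.

The choice starts from [next_perm], whose cycles on positive darts are the
blocks, and multiplies by one cycle at a time. Two observations suffice.

- If the moved points of [c] lie in pairwise distinct cycles of [p], then the
  cycles of [c * p] are unions of cycles of [p] and of [c] ([merge_orbits]).
  Arbitrary cycles at the rows therefore fuse the blocks of each row, and an
  arbitrary cycle at one column then fuses the rows. At this stage the product
  is already transitive. In graph terms, all the incidences of rows and one
  full column, with a single incidence for every other point, form a spanning
  tree of the incidence graph in which each point has odd degree.

- If a set [S] of odd size lies in one cycle of [p], then some cycle [c] on [S]
  leaves that cycle connected in [c * p] ([odd_cyclic_on]): [S] is built up by
  two elements at a time, and of the two ways to insert them one does not split
  the cycle ([three_cycle_coarser]). As n is odd, this handles every other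
  column and every entry.

Both steps ignore how the blocks are oriented, which is why every orientation
can be realised. *)

Set Implicit Arguments.
Unset Strict Implicit.
Unset Printing Implicit Defensive.

Import GroupScope.

Local Notation head := Defs.head.
Local Notation rev := Defs.rev.

(** * Orbits of products of permutations *)

Section Orbits.

Variable T : finType.
Implicit Types (p q c s t : {perm T}) (S A : {set T}) (x y z a b : T).

Lemma porbit_step s x : porbit s (s x) = porbit s x.
Proof. exact: (porbit_perm s 1). Qed.

Lemma porbit_ind s x (Q : T -> Prop) :
  Q x -> (forall y, y \in porbit s x -> Q y -> Q (s y)) ->
  forall y, y \in porbit s x -> Q y.
Proof.
move=> Qx Qs _ /porbitP[i ->]; elim: i => [|i IHi]; first by rewrite perm1.
by rewrite expgSr permM; apply: Qs; first exact: mem_porbit.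
Qed.

Lemma eq_porbit_on A s t : {in A, forall x, s x \in A} ->
  {in A, forall x, t x = s x} -> {in A, porbit s =1 porbit t}.
Proof.
move=> sA tsA x xA; have Ai i : (s ^+ i) x \in A.
  by elim: i => [|i IHi]; rewrite ?perm1 // expgSr permM sA.
have ts i : (t ^+ i) x = (s ^+ i) x.
  by elim: i => [|i IHi]; rewrite ?perm1 // !expgSr !permM IHi tsA.
by apply/setP=> y; apply/porbitP/porbitP=> -[i ->]; exists i; rewrite ts.
Qed.

Definition coarser p q := forall x y, y \in porbit p x -> y \in porbit q x.

Lemma coarser_step p q : (forall x, p x \in porbit q x) -> coarser p q.
Proof.
move=> pq x; apply: porbit_ind => [|y _ qxy]; first exact: porbit_id.
by rewrite -eq_porbit_mem in qxy; rewrite -(eqP qxy).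
Qed.

Lemma coarser_trans p q s : coarser p q -> coarser q s -> coarser p s.
Proof. by move=> pq qs x y /pq/qs. Qed.

Lemma coarser_eq p q x y : coarser p q -> y \in porbit p x ->
  porbit q y = porbit q x.
Proof. by move=> pq /pq qxy; apply/eqP; rewrite eq_porbit_mem. Qed.

(** Multiplication by [c] fuses orbits, and never splits one, as long as each
orbit of [p] has at most one point moved by [c]: a walk of [c * p] that enters
such an orbit has to run through all of it before it leaves. *)
Lemma merge_orbits p c :
    (forall x y, c x != x -> c y != y -> y \in porbit p x -> y = x) ->
  coarser p (c * p) /\ coarser c (c * p).
Proof.
move=> c1p; set q := c * p.
(* The q-walk from p x follows p until it is back at the moved point x. *)
have ret x : c x != x -> x \in porbit q (p x).
  move=> cx.
  have cp i : (p ^+ i) (p x) \in porbit q (p x) \/ x \in porbit q (p x).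
    elim: i => [|i [IHi|]]; [by left; rewrite perm1 porbit_id| |by right].
    have [fix_i|mv_i] := eqVneq (c ((p ^+ i) (p x))) ((p ^+ i) (p x)).
      left; rewrite expgSr permM -{1}fix_i -permM.
      by rewrite -eq_porbit_mem porbit_step eq_porbit_mem.
    right; rewrite -{1}(c1p x ((p ^+ i) (p x))) //.
    by rewrite -(porbit_step p) mem_porbit.
  have /porbitP[i xi] : x \in porbit p (p x) by rewrite porbit_step porbit_id.
  by case: (cp i); rewrite -?xi.
have cq x : c x \in porbit q x.
  have [->|cx] := eqVneq (c x) x; first exact: porbit_id.
  have ccx : c (c x) != c x by rewrite (inj_eq perm_inj).
  by move: (ret _ ccx); rewrite -permM porbit_step.
split; apply: coarser_step => // x.
have: c^-1 x \in porbit q x by rewrite porbit_sym -{1}(permKV c x) cq.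
rewrite porbit_sym -!eq_porbit_mem => /eqP->.
by rewrite -(porbit_step q (c^-1 x)) permM permKV.
Qed.

Lemma tperm_moved a b x : tperm a b x != x -> x = a \/ x = b.
Proof. by case: tpermP; auto; rewrite eqxx. Qed.

Lemma merge_tperm p a b : a \notin porbit p b ->
  coarser p (tperm a b * p) /\ a \in porbit (tperm a b * p) b.
Proof.
move=> pab; have [|pq cq] := @merge_orbits p (tperm a b).
  move=> x y /tperm_moved[]-> /tperm_moved[]-> //; last by rewrite (negPf pab).
  by rewrite porbit_sym (negPf pab).
by split=> //; apply: cq; rewrite -{1}(tpermR a b) -(porbit_step _ b) porbit_id.
Qed.

(** That [a] and [b] are separated comes from the count of orbits: together with
[merge_tperm] this is the classical fact that a transposition changes the number
of orbits by one. *)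
Lemma split_tperm p a b : a != b -> a \in porbit p b ->
  let q := tperm a b * p in
  a \notin porbit q b /\
  forall x, x \in porbit p a -> x \in porbit q a \/ x \in porbit q b.
Proof.
move=> neq_ab pab q; split=> [|x]; last first.
  elim/porbit_ind => [|{}x _ IHx]; first by left; exact: porbit_id.
  have qx := porbit_step q; have [xa|nxa] := eqVneq a x.
    by right; rewrite -(qx b) permM tpermR xa porbit_id.
  have [xb|nxb] := eqVneq b x.
    by left; rewrite -(qx a) permM tpermL xb porbit_id.
  have ->: p x = q x by rewrite permM tpermD.
  by case: IHx; rewrite -!eq_porbit_mem qx => ->; auto.
have := porbits_mul_tperm q a b; have := porbits_mul_tperm p a b.
rewrite /q tpermKg pab neq_ab /= addn0 -/q => ->; case: (_ \notin _) => //=.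
by rewrite double0 addn0 -addnA => /eqP; rewrite -{1}[#|_|]addn0 eqn_add2l.
Qed.

(** The product of the two transpositions is a 3-cycle on [a], [b] and [d]. The
first one splits the orbit into two, one containing [a] and the other [b]; as
[d] lies in one of them, a transposition of [d] with the point [e] in the other
joins them again. The two values of [e] give the two 3-cycles on these points. *)
Lemma three_cycle_coarser p a b d : uniq [:: a; b; d] -> b \in porbit p a ->
    d \in porbit p a ->
  exists2 e, e \in [:: a; b] & coarser p (tperm d e * (tperm b a * p)).
Proof.
rewrite /= !inE negb_or andbT => /andP[/andP[nab nad] nbd] pab pad.
rewrite eq_sym in nab.
have [qab qcov] := split_tperm nab pab; set q := tperm b a * p in qab qcov *.
have pba : porbit p b = porbit p a by apply/eqP; rewrite eq_porbit_mem.
have q_ad : d \in porbit q b \/ d \in porbit q a.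
  by apply: qcov; rewrite pba.
(* [e] is the one of [a], [b] that is not in the orbit of [d] under [q]. *)
have [e eab [qq' q'ab]] : exists2 e, e \in [:: a; b] &
    coarser q (tperm d e * q) /\
    porbit (tperm d e * q) a = porbit (tperm d e * q) b.
  have merge u v : u \in porbit q d -> v \notin porbit q u ->
      coarser q (tperm d v * q) /\
      porbit (tperm d v * q) u = porbit (tperm d v * q) v.
    move=> qud nqvu; have [|qq' q'dv] := @merge_tperm q d v.
      apply: contra nqvu; rewrite porbit_sym -!eq_porbit_mem => /eqP->.
      by rewrite eq_sym eq_porbit_mem.
    split=> //; move/qq': qud; rewrite -eq_porbit_mem => /eqP->.
    by apply/eqP; rewrite eq_porbit_mem.
  case: q_ad; rewrite porbit_sym => qd.
    exists a; rewrite ?inE ?eqxx //; have [|? ->] := merge b a qd; last by split.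
    by rewrite porbit_sym.
  by exists b; rewrite ?inE ?eqxx ?orbT //; exact: merge.
exists e => //; set q' := _ * q in qq' q'ab *.
have q'cov x : x \in porbit p a -> porbit q' x = porbit q' a.
  rewrite -pba => /qcov.
  by case=> /qq'; rewrite -?q'ab -eq_porbit_mem => /eqP.
apply: coarser_step => x; have [pax|npax] := boolP (x \in porbit p a).
  rewrite -eq_porbit_mem q'cov ?(q'cov x) //.
  by rewrite -eq_porbit_mem porbit_step eq_porbit_mem.
have nx y : y \in porbit p a -> y != x.
  by move=> pay; apply: contraNneq npax => <-.
have -> : p x = q' x.
  rewrite !permM !(tpermD (nx _ _)) ?nx ?porbit_id //.
  by move: eab; rewrite !inE => /orP[]/eqP->; rewrite ?porbit_id.
by rewrite -(porbit_step q') porbit_id.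
Qed.

(** Prescribing all the orbits makes [c] trivial outside [S], and allows [S] to be
empty. *)
Definition cyclic_on S c :=
  forall x, porbit c x = if x \in S then S else [set x].

Lemma porbit1_fix c x : porbit c x = [set x] -> c x = x.
Proof. by move=> cx; apply/set1P; rewrite -cx -(porbit_step c) porbit_id. Qed.

Lemma fix_porbit1 c x : c x = x -> porbit c x = [set x].
Proof.
move=> cx; apply/setP=> y; rewrite inE.
apply/idP/eqP=> [|->]; last exact: porbit_id.
by elim/porbit_ind=> // _ _ ->.
Qed.

Lemma cyclic_on_sub1 S : #|S| <= 1 -> cyclic_on S 1.
Proof.
move=> /card_le1_eqP S1 x; rewrite fix_porbit1 ?perm1 //.
case: ifP => // xS; apply/setP=> y; rewrite inE; apply/eqP/idP => [->|yS] //.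
exact: S1.
Qed.

Lemma cyclic_on_mem S c x : cyclic_on S c -> (c x \in S) = (x \in S).
Proof.
move=> cS; have := porbit_step c x; rewrite !cS.
case: (boolP (x \in S)) (boolP (c x \in S)) => [xS|nxS] [cxS|ncxS] // eqS.
  by rewrite -eqS set11 in ncxS.
by rewrite eqS set11 in nxS.
Qed.

Lemma cyclic_on_extend S c a b : cyclic_on S c -> b \in S -> a \notin S ->
  cyclic_on (a |: S) (tperm a b * c).
Proof.
move=> cS bS naS; set q := _ * c; have ab : a != b by apply: contraNneq naS => ->.
have ca : c a = a by apply: porbit1_fix; rewrite cS (negPf naS).
have [|cq qab] := @merge_tperm c a b; first by rewrite cS bS.
have qb : porbit q b = a |: S.
  apply/setP=> x; apply/idP/idP; last first.
    by rewrite !inE => /orP[/eqP->//|xS]; apply: cq; rewrite cS bS.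
  elim/porbit_ind=> [|{}x _]; first by rewrite !inE bS orbT.
  rewrite !inE permM => /orP[/eqP->|xS].
    by rewrite tpermL cyclic_on_mem // bS orbT.
  by case: tpermP => [_|_|_ _]; rewrite ?ca ?eqxx // cyclic_on_mem // ?bS ?xS orbT.
move=> x; case: ifP => xA.
  by rewrite -qb in xA *; apply/eqP; rewrite eq_porbit_mem.
move: xA; rewrite !inE => /norP[nxa nxS].
rewrite fix_porbit1 // permM tpermD 1?eq_sym //; last first.
  by apply: contraNneq nxS => ->.
by apply: porbit1_fix; rewrite cS (negPf nxS).
Qed.

Lemma cyclic_on_exists S : exists c, cyclic_on S c.
Proof.
have [m] := ubnP #|S|; elim: m S => // m IHm S; rewrite ltnS => leSm.
have [S1|] := leqP #|S| 1; first by exists 1; exact: cyclic_on_sub1.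
rewrite -[1%N]/(0.+1) => S_gt1; have /card_gt0P[a aS] := ltnW S_gt1.
have cardS := cardsD1 a S; rewrite aS add1n in cardS.
have [c cS] : exists c, cyclic_on (S :\ a) c by apply: IHm; rewrite -cardS.
have /card_gt0P[s sS] : 0 < #|S :\ a| by rewrite -ltnS -cardS.
exists (tperm a s * c); rewrite -(setD1K aS).
by apply: cyclic_on_extend; rewrite ?setD11.
Qed.

(** By induction on the size of [S], two elements at a time: whichever 3-cycle
[three_cycle_coarser] provides, it extends a cycle on the smaller set to one
on [S]. *)
Lemma odd_cyclic_on p S : odd #|S| ->
    {in S &, forall x y, y \in porbit p x} ->
  exists2 c, cyclic_on S c & coarser p (c * p).
Proof.
have [m] := ubnP #|S|; elim: m S => // m IHm S; rewrite ltnS => leSm oddS pS.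
have [S1|S_gt1] := leqP #|S| 1.
  by exists 1; [exact: cyclic_on_sub1 | rewrite mul1g => x y].
have /card_gt0P[b bS] := ltnW S_gt1.
have cardS := cardsD1 b S; rewrite bS add1n in cardS.
have /card_gt0P[d dS] : 0 < #|S :\ b| by rewrite -ltnS -cardS.
have cardS' := cardsD1 d (S :\ b); rewrite dS add1n in cardS'.
set S' := S :\ b :\ d in cardS'.
have oddS' : odd #|S'| by rewrite cardS cardS' /= negbK in oddS.
have sS'S : {subset S' <= S} by move=> x; rewrite !inE => /and3P[].
have [] := IHm S' _ oddS' (sub_in2 sS'S pS).
  by rewrite (leq_trans _ leSm) // cardS cardS' ltnS leqnSn.
move=> c cS' pcp; have /card_gt0P[a aS'] := odd_gt0 oddS'.
have [nbS' ndS'] : b \notin S' /\ d \notin S' by rewrite !inE !eqxx !andbF.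
have abd : uniq [:: a; b; d].
  rewrite /= !inE negb_or andbT; move: aS' dS; rewrite !inE => /and3P[-> -> _].
  by rewrite eq_sym => /andP[].
have [||e eab cq] := @three_cycle_coarser (c * p) a b d abd.
- by apply: pcp; apply: pS; first exact: sS'S.
- by apply: pcp; apply: pS; [exact: sS'S | case/setD1P: dS].
exists (tperm d e * (tperm b a * c)).
  have -> : S = d |: (b |: S').
    by rewrite setUCA /S' setD1K ?setD1K.
  apply: cyclic_on_extend; first exact: (cyclic_on_extend cS' aS' nbS').
    move: eab; rewrite mem_seq2 => /pred2P[]->; rewrite in_setU1 ?eqxx //.
    by rewrite aS' orbT.
  by rewrite in_setU1 (negPf ndS') orbF; case/and3P: abd => _; rewrite inE eq_sym.
by rewrite -!mulgA; exact: coarser_trans pcp cq.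
Qed.

End Orbits.

(** * Simultaneous cycles on the fibres of a map *)

Lemma finset_ind (W : finType) (Q : {set W} -> Prop) : Q set0 ->
  (forall w (D : {set W}), w \notin D -> Q D -> Q (w |: D)) -> forall D, Q D.
Proof.
move=> Q0 QU D; have [m] := ubnP #|D|; elim: m D => // m IHm D leDm.
have [->//|[w wD]] := set_0Vmem D.
rewrite -(setD1K wD); apply: QU; first by rewrite setD11.
by apply: IHm; rewrite (cardsD1 w D) wD in leDm.
Qed.

Section Fibres.

Variables (T W : finType) (g : T -> W).
Implicit Types (c p : {perm T}) (D : {set W}).

Definition fibre w := [set x | g x == w].

Definition fibre_cycles D c :=
  forall x, porbit c x = if g x \in D then fibre (g x) else [set x].

Lemma fibre_cycles_mem D c x : fibre_cycles D c -> g (c x) = g x.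
Proof.
move=> cD; have: c x \in porbit c x by rewrite -(porbit_step c) porbit_id.
by rewrite cD; case: ifP; rewrite inE => _ /eqP// ->.
Qed.

Lemma fibre_cycles_fix D c x : fibre_cycles D c -> g x \notin D -> c x = x.
Proof. by move=> cD nDx; apply: porbit1_fix; rewrite cD (negPf nDx). Qed.

Lemma fibre_cycles_moved D c x : fibre_cycles D c -> c x != x -> g x \in D.
Proof. by move=> cD; apply: contraNT => /(fibre_cycles_fix cD)->. Qed.

Lemma fibre_cyclesU D1 D2 c1 c2 : [disjoint D1 & D2] ->
    fibre_cycles D1 c1 -> fibre_cycles D2 c2 ->
  fibre_cycles (D1 :|: D2) (c1 * c2).
Proof.
move=> dD cD1 cD2 x; have in_fibre D c : fibre_cycles D c ->
    {in fibre (g x), forall y, c y \in fibre (g x)}.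
  by move=> cD y; rewrite !inE (fibre_cycles_mem _ cD).
have x_x : x \in fibre (g x) by rewrite inE.
rewrite inE; have [D1x|nD1x] /= := boolP (g x \in D1).
  rewrite -(eq_porbit_on (in_fibre _ _ cD1)) // ?cD1 ?D1x // => y.
  rewrite inE permM => /eqP gy; apply: (fibre_cycles_fix cD2).
  by rewrite (fibre_cycles_mem _ cD1) gy (disjointFr dD).
rewrite -cD2; apply/esym/(eq_porbit_on (in_fibre _ _ cD2)) => // y.
by rewrite inE permM => /eqP gy; rewrite (fibre_cycles_fix cD1) // gy.
Qed.

Lemma cyclic_on_fibre w c : cyclic_on (fibre w) c -> fibre_cycles [set w] c.
Proof. by move=> cw x; rewrite cw !inE; case: eqP => // ->. Qed.

Lemma fibre_cycles0 : fibre_cycles set0 1.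
Proof. by move=> x; rewrite inE fix_porbit1 ?perm1. Qed.

Lemma fibre_cycles_exists D : exists c, fibre_cycles D c.
Proof.
elim/finset_ind: D => [|w D nDw [c cD]]; first by exists 1; exact: fibre_cycles0.
have [c1 /cyclic_on_fibre c1w] := cyclic_on_exists (fibre w).
by exists (c1 * c); apply: fibre_cyclesU => //; rewrite disjoints1.
Qed.

(** The fibres are treated one after the other; coarsening keeps each remaining
fibre inside one orbit, so that [odd_cyclic_on] continues to apply. *)
Lemma odd_fibre_cycles p D : {in D, forall w, odd #|fibre w|} ->
    (forall x y, g x \in D -> g y = g x -> y \in porbit p x) ->
  exists2 c, fibre_cycles D c & coarser p (c * p).
Proof.
elim/finset_ind: D => [|w D nDw IHD] oddD pD.
  by exists 1; [exact: fibre_cycles0 | rewrite mul1g => x y].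
have [w' Dw'|x y Dx|c cD pc] := IHD; first by apply: oddD; rewrite setU1r.
  by apply: pD; rewrite setU1r.
have [|x y|c1 /cyclic_on_fibre c1w pc1] := @odd_cyclic_on _ (c * p) (fibre w).
- by rewrite oddD ?setU11.
- rewrite !inE => /eqP gx /eqP gy; apply: pc; apply: pD; last by rewrite gx.
  by rewrite gx setU11.
exists (c1 * c); first by apply: fibre_cyclesU => //; rewrite disjoints1.
by rewrite -mulgA; exact: coarser_trans pc pc1.
Qed.

End Fibres.

(** * Darts and blocks of a triple system *)

Section TripleSystem.

Variables (V : finType) (X : triple_system V).
Local Notation dart := (dart X).
Implicit Types (d e : dart) (B C : {set V}).

Lemma dart_eq d e : tail d = tail e -> head d = head e -> d = e.
Proof.
rewrite /tail /head => tt hh; apply: val_inj.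
by rewrite (surjective_pairing (val d)) tt hh -surjective_pairing.
Qed.

Lemma block_eq u v B C : u != v -> B \in blocks X -> C \in blocks X ->
  u \in B -> v \in B -> u \in C -> v \in C -> B = C.
Proof.
move=> uv BX CX uB vB uC vC; have /card_le1_eqP := block_pair X uv.
by apply; rewrite inE subUset !sub1set ?BX ?CX ?uB ?uC.
Qed.

Lemma tail_head d : tail d != head d.
Proof. by have /andP[] := valP d. Qed.

Lemma third_subproof d : exists w,
  [&& w != tail d, w != head d & [set tail d; head d; w] \in blocks X].
Proof.
have /andP[_ /existsP[B /andP[BX]]] := valP d.
rewrite subUset !sub1set => /andP[tB hB].
have := block_card BX; rewrite (cardsD1 (tail d)) tB (cardsD1 (head d)).
rewrite !inE eq_sym tail_head hB => -[] /eqP/cards1P[w Bw].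
have: w \in B :\ tail d :\ head d by rewrite Bw set11.
rewrite !inE => /and3P[wh wt _]; exists w; rewrite wh wt.
by rewrite -setUA -Bw setD1K ?setD1K // !inE hB eq_sym tail_head.
Qed.

Definition third d := xchoose (third_subproof d).
Definition block_of d := [set tail d; head d; third d].

Lemma third_tail d : third d != tail d.
Proof. by have /and3P[] := xchooseP (third_subproof d). Qed.

Lemma third_head d : third d != head d.
Proof. by have /and3P[] := xchooseP (third_subproof d). Qed.

Lemma block_of_block d : block_of d \in blocks X.
Proof. by have /and3P[] := xchooseP (third_subproof d). Qed.

Lemma block_ofP d B : B \in blocks X -> tail d \in B -> head d \in B ->
  block_of d = B.
Proof.
move=> BX tB hB; apply: block_eq (tail_head d) (block_of_block d) BX _ _ tB hB.
  by rewrite !inE eqxx.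
by rewrite !inE eqxx orbT.
Qed.

Lemma third_eq d w : w \in block_of d -> w != tail d -> w != head d ->
  third d = w.
Proof. by rewrite !inE => /orP[/orP[]|] /eqP->; rewrite ?eqxx. Qed.

Lemma turn_subproof d : adj X (tail d, third d).1 (tail d, third d).2.
Proof.
rewrite /adj /= eq_sym third_tail; apply/existsP; exists (block_of d).
by rewrite block_of_block subUset !sub1set !inE !eqxx ?orbT.
Qed.

(** The other dart that leaves the tail of [d] inside the block of [d]: the two
are neighbours in the rotation when the block is a face. *)
Definition turn d : dart := Sub (tail d, third d) (turn_subproof d).

Lemma block_of_turn d : block_of (turn d) = block_of d.
Proof. by apply: block_ofP; rewrite ?block_of_block // !inE eqxx ?orbT. Qed.

Lemma block_of_rev d : block_of (rev d) = block_of d.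
Proof. by apply: block_ofP; rewrite ?block_of_block // !inE eqxx ?orbT. Qed.

Lemma third_turn d : third (turn d) = head d.
Proof.
apply: third_eq; first by rewrite block_of_turn !inE eqxx orbT.
  by rewrite eq_sym; exact: (tail_head d).
by rewrite eq_sym; exact: (third_head d).
Qed.

Lemma third_rev d : third (rev d) = third d.
Proof.
apply: third_eq; first by rewrite block_of_rev !inE eqxx orbT.
  exact: (third_head d).
exact: (third_tail d).
Qed.

Lemma turnK : involutive turn.
Proof. by move=> d; apply: dart_eq => //; apply: third_turn. Qed.

Lemma revK : involutive (@rev V X).
Proof. by move=> d; apply: dart_eq. Qed.

Definition turn_perm : {perm dart} := perm (inv_inj turnK).
Definition rev_perm : {perm dart} := perm (@rev_inj V X).
(** The step (u, v) |-> (v, w) along the block {u, v, w}, for either direction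
of travel. *)
Definition next_perm : {perm dart} := rev_perm * turn_perm.

Lemma next_permE d : next_perm d = turn (rev d).
Proof. by rewrite permM !permE. Qed.

Lemma block_of_next d : block_of (next_perm d) = block_of d.
Proof. by rewrite next_permE block_of_turn block_of_rev. Qed.

Lemma tail_next d : tail (next_perm d) = head d.
Proof. by rewrite next_permE. Qed.

Lemma head_next d : head (next_perm d) = third d.
Proof. by rewrite next_permE -third_rev. Qed.

Lemma porbit_next_tail d v : v \in block_of d ->
  exists2 e, e \in porbit next_perm d & tail e = v.
Proof.
rewrite !inE => /orP[/orP[]|] /eqP->.
- by exists d; rewrite ?porbit_id.
- by exists (next_perm d); rewrite ?tail_next // -(porbit_step _ d) porbit_id.
exists (next_perm (next_perm d)); last by rewrite tail_next head_next.
by rewrite -(porbit_step _ d) -porbit_step porbit_id.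
Qed.

Lemma block_of_exists B : B \in blocks X -> exists d, block_of d = B.
Proof.
move=> BX; have: 1 < #|B| by rewrite (block_card BX).
case/card_gt1P=> u [v [uB vB uv]].
have uvX : adj X (u, v).1 (u, v).2.
  by rewrite /adj uv; apply/existsP; exists B; rewrite BX subUset !sub1set uB.
by exists (Sub (u, v) uvX); apply: block_ofP.
Qed.

(** * From a transitive product to an upper embedding *)

Section Orientation.

Variables (o : {set V} -> {perm V}) (ho : orientation_of_triples X o).

Lemma orientP B x : B \in blocks X -> x \in B ->
  [/\ o B x \in B, o B x != x & o B (o B x) != x].
Proof.
move=> BX xB; have [oB /(_ x xB) orb] := ho BX.
have := uniq_traject_porbit (o B) x.
rewrite orb (block_card BX) /= !inE negb_or => /andP[/andP[xo xoo] _].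
by rewrite perm_closed // xB eq_sym xo eq_sym.
Qed.

Definition pos d := o (block_of d) (tail d) == head d.

Lemma pos_turn d : pos (turn d) = ~~ pos d.
Proof.
have tB : tail d \in block_of d by rewrite !inE eqxx.
have [oB ox _] := orientP (block_of_block d) tB.
rewrite /pos block_of_turn; change (tail (turn d)) with (tail d).
change (head (turn d)) with (third d).
move: oB ox; rewrite !inE => /orP[/orP[]|] /eqP->; rewrite ?eqxx //.
  by move=> _; rewrite eq_sym (negPf (third_head d)).
by rewrite third_head.
Qed.

Lemma pos_rev d : pos (rev d) = ~~ pos d.
Proof.
have hB : head d \in block_of d by rewrite !inE eqxx orbT.
have tB : tail d \in block_of d by rewrite !inE eqxx.
have [oB oh _] := orientP (block_of_block d) hB.
have [_ _ oot] := orientP (block_of_block d) tB.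
rewrite {1}/pos block_of_rev; change (tail (rev d)) with (head d).
change (head (rev d)) with (tail d).
have [/eqP pd|] := boolP (pos d); first by rewrite -pd (negPf oot).
rewrite -pos_turn /pos block_of_turn; change (tail (turn d)) with (tail d).
change (head (turn d)) with (third d) => /eqP ot.
move: oB oh; rewrite !inE => /orP[/orP[->//|->//]|].
by rewrite -ot (inj_eq perm_inj) eq_sym (negPf (tail_head d)).
Qed.

Lemma pos_next d : pos (next_perm d) = pos d.
Proof. by rewrite next_permE pos_turn pos_rev negbK. Qed.

Lemma pos_inj d e : pos d = pos e -> block_of d = block_of e ->
  tail d = tail e -> d = e.
Proof.
move=> pp bb tt; apply: dart_eq => //.
case: (boolP (pos d)) (pp) => pd; move/esym=> pe.
  by rewrite -(eqP pd) -(eqP pe) bb tt.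
have: pos (rev d) by rewrite pos_rev.
have: pos (rev e) by rewrite pos_rev pe.
rewrite /pos !block_of_rev bb => /eqP he /eqP hd.
by apply: (@perm_inj _ (o (block_of e))); rewrite hd he.
Qed.

(** Each block carries two orbits of [next_perm], one for each direction. *)
Lemma porbit_next d :
  porbit next_perm d = [set e | (pos e == pos d) && (block_of e == block_of d)].
Proof.
apply/setP=> e; rewrite inE; apply/idP/andP=> [|[/eqP pe /eqP be]].
  elim/porbit_ind=> [|y _ [/eqP<- /eqP<-]]; first by rewrite !eqxx.
  by rewrite pos_next block_of_next.
have [|e' de'] := @porbit_next_tail d (tail e); first by rewrite -be !inE eqxx.
suff [pe' be'] : pos e' = pos d /\ block_of e' = block_of d.
  by move=> te; rewrite (_ : e = e') //; apply: pos_inj; rewrite ?pe ?be.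
elim/porbit_ind: e' / de' => // y _ [<- <-]; by rewrite pos_next block_of_next.
Qed.

(** The value [None] collects all negative darts, so that [sigma] is described by
its orbits on the fibres other than that of [None]. *)
Definition pos_tail d := if pos d then Some (tail d) else None.

Definition block_darts B := [set d | pos d && (block_of d == B)].

Lemma block_darts_bounds B : B \in blocks X -> bounds (block_darts B) B.
Proof.
move=> BX; have tB : [set tail d | d in block_darts B] = B.
  apply/setP=> v; apply/imsetP/idP=> [[d]|vB].
    by rewrite inE => /andP[_ /eqP<-] ->; rewrite !inE eqxx.
  have [d0 dB] := block_of_exists BX.
  have [d pd {}dB] : exists2 d, pos d & block_of d = B.
    have [pd|nd] := boolP (pos d0); first by exists d0.
    by exists (rev d0); rewrite ?pos_rev ?block_of_rev.
  have [|e] := @porbit_next_tail d v; first by rewrite dB.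
  rewrite porbit_next inE pd dB => /andP[/eqP pe be] <-.
  by exists e; rewrite // inE pe.
split=> //; rewrite -(block_card BX) -[in RHS]tB card_in_imset // => d e.
rewrite !inE => /andP[pd /eqP dB] /andP[pe /eqP eB].
by apply: pos_inj; rewrite ?pd ?pe ?dB ?eB.
Qed.

Lemma pos_dart_exists B v : B \in blocks X -> v \in B ->
  exists d, [/\ pos d, block_of d = B & tail d = v].
Proof.
move=> /block_darts_bounds[_ {1}<-] /imsetP[d].
by rewrite inE => /andP[pd /eqP dB] ->; exists d.
Qed.

(** Each block at [v] has exactly one positive dart leaving [v]. *)
Lemma card_pos_darts v :
  #|fibre pos_tail (Some v)| = #|[set B in blocks X | v \in B]|.
Proof.
have fibreE d : (d \in fibre pos_tail (Some v)) = pos d && (tail d == v).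
  by rewrite inE /pos_tail; case: (pos d).
rewrite -(@card_in_imset _ _ block_of) => [|d e]; last first.
  rewrite !fibreE => /andP[pd /eqP dv] /andP[pe /eqP ev] /pos_inj.
  by apply; rewrite ?pd ?pe ?dv ?ev.
apply: eq_card => B; rewrite inE; apply/imsetP/andP=> [[d]|[BX vB]].
  rewrite fibreE => /andP[_ /eqP<-] ->; split; first exact: block_of_block.
  by rewrite !inE eqxx.
have [d [pd dB dv]] := pos_dart_exists BX vB.
by exists d; rewrite // fibreE pd dv eqxx.
Qed.

Section Rotation.

Variable sigma : {perm dart}.
Hypothesis sigmaP : fibre_cycles pos_tail [set~ None] sigma.

Lemma sigma_neg d : ~~ pos d -> sigma d = d.
Proof.
move=> nd; apply: (fibre_cycles_fix sigmaP).
by rewrite !inE /pos_tail (negPf nd) eqxx.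
Qed.

Lemma pos_sigma d : pos (sigma d) = pos d.
Proof.
by have := fibre_cycles_mem d sigmaP; rewrite /pos_tail; do 2!case: (pos _).
Qed.

Lemma tail_sigma d : tail (sigma d) = tail d.
Proof.
have [pd|/sigma_neg->//] := boolP (pos d).
by have := fibre_cycles_mem d sigmaP; rewrite /pos_tail pos_sigma pd => -[].
Qed.

(** A positive dart goes to the negative dart of its block at the same point, and
from there [sigma] chooses the next block. *)
Definition rotation_perm : {perm dart} := turn_perm * sigma.

(** Two steps of the rotation from a positive dart are one step of [sigma], so that
the orbits of [sigma] are contained in those of the rotation. *)
Lemma rotation_permP d e : (e \in porbit rotation_perm d) = (tail e == tail d).
Proof.
set r := rotation_perm; have rE x : r x = sigma (turn x) by rewrite permM permE.
have same x : porbit r (r x) = porbit r x by apply: porbit_step.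
apply/idP/eqP.
  by elim/porbit_ind=> // x _ <-; rewrite rE tail_sigma.
have sigma_r : coarser sigma r.
  apply: coarser_step => x.
  have [px|/sigma_neg->] := boolP (pos x); last exact: porbit_id.
  rewrite -same -(same (r x)) !rE; set y := turn x.
  rewrite (sigma_neg (_ : ~~ pos y)) ?pos_turn ?px //.
  by rewrite turnK porbit_id.
have to_pos x : exists y, [/\ pos y, tail y = tail x & porbit r y = porbit r x].
  have [px|nx] := boolP (pos x); first by exists x.
  exists (sigma (turn x)); rewrite pos_sigma tail_sigma pos_turn nx.
  by rewrite -rE same.
have [d' [pd <- <-]] := to_pos d; have [e' [pe te re]] := to_pos e.
rewrite -te -eq_porbit_mem -re eq_porbit_mem => te'; apply: sigma_r.
by rewrite sigmaP {1}/pos_tail pd !inE /pos_tail pd pe te'.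
Qed.

Local Notation f := (face_perm rotation_perm).

Lemma face_permE d : f d = turn (sigma^-1 (rev d)).
Proof.
rewrite /face_perm /rotation_perm invMg !permM [perm _ d]permE.
by apply: (@perm_inj _ turn_perm); rewrite permKV [RHS]permE turnK.
Qed.

Lemma pos_face d : pos (f d) = pos d.
Proof.
by rewrite face_permE pos_turn -pos_sigma permKV pos_rev negbK.
Qed.

Lemma pos_face_orbit d e : e \in porbit f d -> pos e = pos d.
Proof. by elim/porbit_ind=> // x _ <-; exact: pos_face. Qed.

Lemma face_pos d : pos d -> porbit f d = block_darts (block_of d).
Proof.
move=> pd; rewrite -(@eq_porbit_on _ [set x | pos x] next_perm f) ?inE //.
- by rewrite porbit_next pd; apply/setP=> e; rewrite !inE eqb_id.
- by move=> x; rewrite !inE pos_next.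
move=> x; rewrite inE => px; rewrite face_permE next_permE.
by rewrite -{1}(sigma_neg (_ : ~~ pos (rev x))) ?permK ?pos_rev ?px.
Qed.

(** Conjugation by [turn] takes [sigma * next_perm] to the inverse of the face
permutation; this carries transitivity from positive to negative darts. *)
Lemma face_turn d e : e \in porbit (sigma * next_perm) d ->
  turn e \in porbit f (turn d).
Proof.
rewrite -(porbitV f); elim/porbit_ind=> [|x _]; first exact: porbit_id.
rewrite -!eq_porbit_mem => /eqP<-; rewrite -(porbit_step _ (turn x)) eq_sym.
rewrite eq_porbit_mem (_ : f^-1 _ = turn ((sigma * next_perm) x)) ?porbit_id //.
apply: (canLR (permK f)); rewrite face_permE permM next_permE turnK revK permK.
by [].
Qed.

(** The faces through positive darts are the blocks in the prescribed
orientation. The others partition the negative darts, and there is only one of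
them when the product is transitive. *)
Lemma upper_embedding_of_rotation :
    (forall u v, connect (adj X) u v) -> blocks X != set0 ->
    (forall d e, pos d -> pos e -> e \in porbit (sigma * next_perm) d) ->
  exists E : embedding X, upper_embedding E /\ induces E o.
Proof.
move=> connX /set0Pn[B0 B0X] trans.
have neg_face d : ~~ pos d -> porbit f d = [set e | ~~ pos e].
  move=> nd; apply/setP=> e; rewrite inE.
  apply/idP/idP => [/pos_face_orbit->//|ne].
  rewrite -(turnK d) -(turnK e); apply: face_turn.
  by apply: trans; rewrite pos_turn.
have dartB B : B \in blocks X -> exists d, d \in block_darts B.
  move=> BX; apply/set0Pn; rewrite -card_gt0.
  by have [-> _] := block_darts_bounds BX.
have inj : {in blocks X &, injective block_darts}.
  move=> B C BX CX eqBC; have [_ <-] := block_darts_bounds BX.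
  by have [_ <-] := block_darts_bounds CX; rewrite eqBC.
have faceB B : B \in blocks X -> block_darts B \in faces rotation_perm.
  move=> /dartB[d]; rewrite inE => /andP[pd /eqP<-].
  by rewrite -face_pos //; apply: imset_f.
pose E := Embedding connX rotation_permP inj faceB block_darts_bounds.
exists E; split; last first.
  by move=> B BX d; rewrite inE /pos => /andP[/eqP + /eqP dB]; rewrite dB.
apply/eqP/cards1P; exists [set e | ~~ pos e].
apply/setP=> F; rewrite !inE; apply/andP/eqP.
  case=> + /imsetP[d _ Fd]; have [pd|/neg_face<-//] := boolP (pos d).
  by rewrite Fd face_pos // imset_f // block_of_block.
have [d] := dartB _ B0X; rewrite inE => /andP[pd _] ->; split.
  apply/imsetP=> -[B /dartB[e eB] defB].
  have: e \in [set e | ~~ pos e] by rewrite defB.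
  by move: eB; rewrite !inE => /andP[->].
by rewrite -(neg_face (turn d)) ?pos_turn ?pd //; apply: imset_f.
Qed.

End Rotation.

End Orientation.

End TripleSystem.

(** * Latin squares of odd order *)

Section LatinSquare.

Variables (n : nat) (L : latin_square n).
Local Notation X := (latin_system L).
Implicit Types (i j k : 'I_n).

Lemma row_pt_mem i i' j : (row_pt i' \in latin_block L i j) = (i' == i).
Proof. by rewrite !inE /= !orbF. Qed.

Lemma col_pt_mem i j j' : (col_pt j' \in latin_block L i j) = (j' == j).
Proof. by rewrite !inE /= !orbF. Qed.

Lemma entry_pt_mem i j k : (entry_pt k \in latin_block L i j) = (k == L i j).
Proof. by rewrite !inE. Qed.

Lemma latin_block_mem i j : latin_block L i j \in blocks X.
Proof. exact: imset2_f. Qed.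

Lemma latin_blockP B : B \in blocks X -> exists i j, B = latin_block L i j.
Proof. by case/imset2P=> i j _ _ ->; exists i, j. Qed.

Lemma entry_col i k : exists j, L i j = k.
Proof.
by exists (invF (@latin_row n L i) k); apply: (f_invF (@latin_row n L i)).
Qed.

Lemma card_blocks_at (v : point n) : #|[set B in blocks X | v \in B]| = n.
Proof.
have card_param (h : 'I_n -> {set point n}) : injective h ->
    (forall i, h i \in blocks X /\ v \in h i) ->
    (forall i j, v \in latin_block L i j -> exists k, latin_block L i j = h k) ->
    #|[set B in blocks X | v \in B]| = n.
  move=> h_inj hX hv; rewrite -[RHS]card_ord -(card_imset _ h_inj).
  apply: eq_card => B; rewrite inE.
  apply/andP/imsetP=> [[]|[k _ ->]]; last exact: hX.
  by case/latin_blockP=> i [j ->] /hv[k ->]; exists k.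
case: v card_param => [[i|j]|k] card_param.
- apply: (card_param (latin_block L i)) => [j j' eqB|j|i' j].
  + by apply/eqP; rewrite -(col_pt_mem i) -eqB col_pt_mem.
  + by rewrite latin_block_mem row_pt_mem.
  + by rewrite row_pt_mem => /eqP<-; exists j.
- apply: (card_param ((latin_block L)^~ j)) => [i i' eqB|i|i j'].
  + by apply/eqP; rewrite -(row_pt_mem _ _ j) -eqB row_pt_mem.
  + by rewrite latin_block_mem col_pt_mem.
  + by rewrite col_pt_mem => /eqP<-; exists i.
pose col i := invF (@latin_row n L i) k.
have colP i : L i (col i) = k by apply: (f_invF (@latin_row n L i)).
apply: (card_param (fun i => latin_block L i (col i))) => [i i' eqB|i|i j].
- by apply/eqP; rewrite -(row_pt_mem _ _ (col i')) -eqB row_pt_mem.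
- by rewrite latin_block_mem entry_pt_mem colP.
rewrite entry_pt_mem => /eqP kij; exists i; congr latin_block.
by apply: (@latin_row n L i); rewrite colP.
Qed.

Lemma adj_block i j u v : u != v -> u \in latin_block L i j ->
  v \in latin_block L i j -> adj X u v.
Proof.
move=> uv uB vB; rewrite /adj uv; apply/existsP; exists (latin_block L i j).
by rewrite latin_block_mem subUset !sub1set uB.
Qed.

Lemma latin_connected (u v : point n) : connect (adj X) u v.
Proof.
have n_gt0 : 0 < n by case: u => [[i|i]|i]; apply: leq_ltn_trans (ltn_ord i).
pose z := Ordinal n_gt0; have symX := sym_connect_sym (@adj_sym _ X).
have rowz i : connect (adj X) (row_pt i) (col_pt z).
  by apply/connect1/(@adj_block i z); rewrite ?row_pt_mem ?col_pt_mem.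
suff hub w : connect (adj X) w (col_pt z).
  by apply: connect_trans (hub u) _; rewrite symX.
case: w => [[i|j]|k]; first exact: rowz.
  apply: connect_trans (rowz z); apply/connect1/(@adj_block z j) => //.
    by rewrite col_pt_mem.
  by rewrite row_pt_mem.
have [j kj] := entry_col z k; apply: connect_trans (rowz z).
apply/connect1/(@adj_block z j) => //; first by rewrite entry_pt_mem kj.
by rewrite row_pt_mem.
Qed.

Lemma row_block_of (d : dart X) i : row_pt i \in block_of d ->
  forall i', (row_pt i' \in block_of d) = (i' == i).
Proof.
have [i1 [j ->]] := latin_blockP (block_of_block d).
by rewrite row_pt_mem => /eqP-> i'; rewrite row_pt_mem.
Qed.

Variable o : {set point n} -> {perm point n}.
Hypothesis ho : orientation_of_triples X o.

(** The cycles at the rows ([c1]) and at the column [z] ([c2]) are arbitrary and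
make the product transitive by [merge_orbits]. Those at the other points ([c3])
come from [odd_fibre_cycles], which preserves transitivity. *)
Lemma latin_rotation : odd n -> exists2 sigma : {perm dart X},
    fibre_cycles (pos_tail o) [set~ None] sigma &
    forall d e, pos o d -> pos o e -> e \in porbit (sigma * next_perm X) d.
Proof.
move=> oddn; pose z := Ordinal (odd_gt0 oddn).
pose g := @pos_tail _ X o; pose tau := next_perm X.
pose D1 := [set Some (row_pt i) | i in 'I_n].
pose D2 := [set Some (@col_pt n z)].
pose D3 := [set~ None] :\: (D2 :|: D1).
have tail_block (d : dart X) : tail d \in block_of d by rewrite !inE eqxx.
have [c1 c1D] := fibre_cycles_exists g D1.
have c1_moved x : c1 x != x -> pos o x /\ exists i, tail x = row_pt i.
  move/(fibre_cycles_moved c1D)/imsetP=> [i _]; rewrite /g /pos_tail.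
  by case: (pos o x) => // -[->]; split=> //; exists i.
(* A block contains a single row point. *)
have [|tau_q1 c1_q1] := @merge_orbits _ tau c1.
  move=> x y /c1_moved[px [i xi]] /c1_moved[py [i' yi']].
  rewrite (porbit_next ho) inE => /andP[_ /eqP byx].
  apply: (pos_inj ho); rewrite ?px ?py // xi yi'; congr row_pt; apply/eqP.
  rewrite -(row_block_of (_ : row_pt i \in block_of x)) -?xi //.
  by rewrite -byx -yi'.
set q1 := c1 * tau in tau_q1 c1_q1.
(* Orbits of [q1] stay within a row, so each meets the column [z] only once. *)
have q1_row x y : y \in porbit q1 x ->
    forall i, (row_pt i \in block_of y) = (row_pt i \in block_of x).
  elim/porbit_ind=> // {}y _ IHy i; rewrite permM block_of_next -IHy.
  have [->//|/c1_moved[py [k yk]]] := eqVneq (c1 y) y.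
  have ty := fibre_cycles_mem y c1D.
  have k_y : row_pt k \in block_of y by rewrite -yk.
  have k_cy : row_pt k \in block_of (c1 y).
    move: ty; rewrite /g /pos_tail py; case: (pos o (c1 y)) => // -[].
    by rewrite yk => <-.
  by rewrite (row_block_of k_y) (row_block_of k_cy).
have [c2 c2D] := fibre_cycles_exists g D2.
have c2_moved x : c2 x != x -> pos o x /\ tail x = col_pt z.
  move/(fibre_cycles_moved c2D); rewrite inE /g /pos_tail.
  by case: (pos o x) => // /eqP[].
have [|q1_q2 c2_q2] := @merge_orbits _ q1 c2.
  move=> x y /c2_moved[px xz] /c2_moved[py yz] /q1_row rows.
  apply: (pos_inj ho); rewrite ?px ?py ?xz ?yz //.
  have [i [j bx]] := latin_blockP (block_of_block x).
  have [i' [j' by_]] := latin_blockP (block_of_block y).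
  have := tail_block x; have := tail_block y; rewrite xz yz bx by_ !col_pt_mem.
  move=> /eqP<- /eqP<-; congr latin_block; apply/eqP.
  by rewrite eq_sym -(row_pt_mem i' i j') -by_ rows bx row_pt_mem.
set q2 := c2 * q1 in q1_q2 c2_q2.
have tau_q2 := coarser_trans tau_q1 q1_q2.
have c1_q2 := coarser_trans c1_q1 q1_q2.
have tau_eq x y : pos o x -> pos o y -> block_of x = block_of y ->
    porbit q2 x = porbit q2 y.
  move=> px py bxy; apply: (coarser_eq tau_q2).
  by rewrite (porbit_next ho) inE px py bxy !eqxx.
have tail_eq c D x y : fibre_cycles g D c -> coarser c q2 ->
    Some (tail y) \in D -> pos o x -> pos o y -> tail x = tail y ->
    porbit q2 x = porbit q2 y.
  move=> cD cq yD px py txy; apply: (coarser_eq cq).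
  by rewrite cD {1}/g /pos_tail py yD inE /g /pos_tail px py txy.
have [e0 [pe0 be0 te0]] := pos_dart_exists ho (latin_block_mem z z)
  (etrans (col_pt_mem z z z) (eqxx z)).
have q2_pos x : pos o x -> porbit q2 x = porbit q2 e0.
  move=> px; have [i [j bx]] := latin_blockP (block_of_block x).
  (* From the cell (i, j), go through its row point to the cell (i, z), and then
     through the column point z to the cell (z, z). *)
  have [a [pa ba ta]] := pos_dart_exists ho (latin_block_mem i j)
    (etrans (row_pt_mem i i j) (eqxx i)).
  have [b [pb bb tb]] := pos_dart_exists ho (latin_block_mem i z)
    (etrans (row_pt_mem i i z) (eqxx i)).
  have [e [pe be te]] := pos_dart_exists ho (latin_block_mem i z)
    (etrans (col_pt_mem i z z) (eqxx z)).
  rewrite (tau_eq x a) ?bx ?ba // (tail_eq c1 D1 a b) ?ta ?tb ?imset_f //.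
  rewrite (tau_eq b e) ?bb ?be // (tail_eq c2 D2 e e0) ?te ?te0 ?inE //.
have [w|x y|c3 c3D q2_q3] := @odd_fibre_cycles _ _ g q2 D3.
- rewrite !inE; case: w => [w _|]; last by rewrite eqxx andbF.
  by rewrite (card_pos_darts ho) card_blocks_at.
- rewrite !inE => /andP[_ gx] gyx; rewrite -eq_porbit_mem.
  have gpos d : g d != None -> pos o d by rewrite /g /pos_tail; case: (pos o d).
  by rewrite !q2_pos // gpos ?gyx.
exists (c3 * (c2 * c1)).
  have -> : [set~ None] = D3 :|: (D2 :|: D1).
    apply/setP=> w; rewrite /D3; have [wD|nwD] := boolP (w \in D2 :|: D1).
      rewrite [in RHS]inE wD orbT; move: wD; rewrite !inE.
      by case: w => // /orP[//|/imsetP[]].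
    by rewrite [in RHS]inE (negPf nwD) orbF in_setD nwD.
  apply: fibre_cyclesU => //; first by rewrite disjoints_subset /D3 setDE subsetIr.
  apply: fibre_cyclesU => //; rewrite disjoints1; apply/imsetP=> -[i _].
  by [].
move=> d e pd pe; rewrite -!mulgA; apply: q2_q3.
by rewrite -eq_porbit_mem !q2_pos.
Qed.

End LatinSquare.

Unset Implicit Arguments.

Theorem theorem1p2 (n : nat) (hn : odd n) (L : latin_square n)
    (o : {set point n} -> {perm point n})
    (ho : orientation_of_triples (latin_system L) o) :
  exists E : embedding (latin_system L), upper_embedding E /\ induces E o.
Proof.
have [sigma sigmaP trans] := latin_rotation ho hn.
apply: (upper_embedding_of_rotation ho sigmaP _ _ trans).
  exact: latin_connected.
pose z := Ordinal (odd_gt0 hn).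
by apply/set0Pn; exists (latin_block L z z); apply: latin_block_mem.
Qed.
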